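(* Let $0<q<1$. The series $$\sum_{n=1}^{\infty}\frac{1}{\xi_n^s}\frac{\mathrm{Cos}_q\xi_n}{\mathrm{Sin}_q'\xi_n}\qquad\text{and}\qquad\sum_{n=1}^{\infty}\frac{1}{\eta_n^s}\frac{\mathrm{Sin}_q\eta_n}{\mathrm{Cos}_q'\eta_n}$$ are absolutely convergent for $\operatorname{Re}s>1$.
   Context: Fix $0<q<1$. $(x;q)_\infty=\prod_{j\ge 0}(1-xq^j)$, $E_q(z)=(-(1-q)z;q)_\infty$, $\mathrm{Sin}_q z=\frac{E_q(iz)-E_q(-iz)}{2i}$, $\mathrm{Cos}_q z=\frac{E_q(iz)+E_q(-iz)}{2}$. All zeros of $\mathrm{Sin}_q$ and $\mathrm{Cos}_q$ are real and simple; $(\xi_k)_{k\ge1}$ and $(\eta_k)_{k\ge1}$ denote their respective positive zeros in increasing order. Primes denote ordinary derivatives. *)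

(* Defs.v *)
From Stdlib Require Import Reals.
From Coquelicot Require Import Coquelicot.
Open Scope C_scope.

Fixpoint qpoch (x : C) (q : R) (n : nat) : C :=
  match n with
  | O => 1
  | S m => qpoch x q m * (1 - x * RtoC (q ^ m)%R)
  end.

(* Limit of a complex sequence, taken coordinatewise in the manner of
   [C_lim]; as with [Lim_seq], it is meaningful only for convergent ones. *)
Definition C_lim_seq (u : nat -> C) : C :=
  (real (Lim_seq (fun n => Re (u n))), real (Lim_seq (fun n => Im (u n)))).

Definition qpoch_inf (x : C) (q : R) : C := C_lim_seq (qpoch x q).

Definition E_q (q : R) (z : C) : C := qpoch_inf (- (1 - RtoC q) * z) q.

Definition Sin_q (q : R) (z : C) : C :=
  (E_q q (Ci * z) - E_q q (- (Ci * z))) / (2 * Ci).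

Definition Cos_q (q : R) (z : C) : C :=
  (E_q q (Ci * z) + E_q q (- (Ci * z))) / 2.

(* [xi 1 < xi 2 < ...] lists exactly the positive zeros of [f]; the value
   [xi 0] is irrelevant. *)
Definition positive_zeros (f : C -> C) (xi : nat -> R) : Prop :=
  (forall k, (1 <= k)%nat -> (0 < xi k)%R /\ f (RtoC (xi k)) = 0) /\
  (forall k, (1 <= k)%nat -> (xi k < xi (S k))%R) /\
  (forall x : R, (0 < x)%R -> f (RtoC x) = 0 ->
     exists k, (1 <= k)%nat /\ xi k = x).

(* Principal power x^s = exp (s ln x) of a real x > 0, in Cartesian form. *)
Definition RCpower (x : R) (s : C) : C :=
  ((Rpower x (Re s) * cos (Im s * ln x))%R,
   (Rpower x (Re s) * sin (Im s * ln x))%R).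

(* Absolute convergence of the sum of [a n] over n >= 1. *)
Definition abs_convergent_from1 (a : nat -> C) : Prop :=
  ex_series (fun n => Cmod (a (S n))).

(* Main.v *)
(** For real [x], [E_q (i x) = prod_j (1 + i b_j x)] with [b_j = (1 - q) q^j],
    so [E_q (i x) = exp (L x) * (cos (T x) + i sin (T x))] where
    [T x = sum_j atan (b_j x)] and [L x = sum_j ln (1 + (b_j x)^2) / 2]; hence
    [Sin_q = exp L * sin T] and [Cos_q = exp L * cos T] on the real line.
    At a zero of either function the quotient in the series is [1 / T' x] up to
    sign, and [x * T' x] is bounded below on half-lines [x >= x1 > 0].  Since
    [T] increases and [T (x / q) - T x = atan (b_0 x / q) < PI / 2], two zeros
    differ at least by the factor [1 / q], so the terms of the series decay
    geometrically as soon as [Re s > 1]. *)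

Require Import Defs.
From Stdlib Require Import Reals Lra Lia.
From Coquelicot Require Import Coquelicot.
Open Scope R_scope.

(** * Elementary real calculus *)

Lemma is_derive_of_quadratic_error (g : R -> R) (x l K : R) :
  (forall y, Rabs (g y - g x - l * (y - x)) <= K * (y - x) ^ 2) ->
  is_derive g x l.
Proof.
  intros H. apply is_derive_Reals. intros eps Heps.
  assert (HK : 0 <= Rabs K) by apply Rabs_pos.
  (* The difference quotient is off by at most [K * Rabs h]; adding 1 keeps the denominator positive
     when [K = 0]. *)
  assert (Hd : 0 < eps / (Rabs K + 1)) by (apply Rdiv_lt_0_compat; lra).
  exists (mkposreal _ Hd). intros h Hh0 Hh. simpl in Hh.
  specialize (H (x + h)). replace (x + h - x) with h in H by ring.
  replace ((g (x + h) - g x) / h - l) with ((g (x + h) - g x - l * h) / h)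
    by (field; exact Hh0).
  unfold Rdiv. rewrite Rabs_mult, Rabs_inv.
  assert (Hah : 0 < Rabs h) by (apply Rabs_pos_lt; exact Hh0).
  apply Rmult_lt_reg_r with (Rabs h); [exact Hah|].
  rewrite Rmult_assoc, Rinv_l, Rmult_1_r by lra.
  apply Rmult_lt_compat_r with (r := Rabs K + 1) in Hh; [|lra].
  replace (eps / (Rabs K + 1) * (Rabs K + 1)) with eps in Hh by (field; lra).
  rewrite <- (pow2_abs h) in H. pose proof (Rle_abs K). nra.
Qed.

(** The intermediate point is located only by its distance to [x]: this covers both orders of [x]
    and [y] and is the form that a Lipschitz bound on [d] consumes. *)
Lemma mvt_everywhere (f d : R -> R) (x y : R) :
  (forall u, is_derive f u (d u)) ->
  exists u, Rabs (u - x) <= Rabs (y - x) /\ f y - f x = d u * (y - x).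
Proof.
  intros Hf. destruct (MVT_gen f x y d) as [u [Hu E]].
  - intros; apply Hf.
  - intros u _. apply derivable_continuous_pt. exists (d u).
    apply is_derive_Reals, Hf.
  - exists u. split; [|exact E].
    revert Hu. unfold Rmin, Rmax. destruct (Rle_dec x y); intros Hu;
    unfold Rabs; repeat destruct Rcase_abs; lra.
Qed.

Lemma ex_series_Rabs_le (u v : nat -> R) :
  (forall n, Rabs (u n) <= v n) -> ex_series v -> ex_series u.
Proof. intros H Hv. apply (ex_series_le u v); [exact H | exact Hv]. Qed.

(** * Termwise differentiation of series of dilates, common to the phase and the log-modulus *)

Section DilationSeries.

Variables (f d : R -> R) (b : nat -> R).
Hypothesis f_derive : forall u, is_derive f u (d u).
Hypothesis d_bound : forall u, Rabs (d u) <= 1.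
Hypothesis d_lipschitz : forall u v, Rabs (d u - d v) <= Rabs (u - v).
Hypothesis f_0 : f 0 = 0.
Hypothesis b_range : forall j, 0 <= b j <= 1.
Hypothesis b_summable : ex_series b.

Lemma ex_series_dilation (x : R) : ex_series (fun j => f (b j * x)).
Proof.
  apply ex_series_Rabs_le with (fun j => Rabs x * b j).
  - intros j. destruct (mvt_everywhere f d 0 (b j * x) f_derive) as [u [_ E]].
    rewrite f_0, !Rminus_0_r in E. rewrite E, !Rabs_mult.
    rewrite (Rabs_pos_eq (b j)) by apply b_range.
    pose proof (d_bound u). pose proof (Rabs_pos x). pose proof (b_range j).
    assert (0 <= b j * Rabs x) by nra. nra.
  - apply (ex_series_scal_l (Rabs x) b b_summable).
Qed.

Lemma ex_series_dilation_derive (x : R) :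
  ex_series (fun j => b j * d (b j * x)).
Proof.
  apply ex_series_Rabs_le with b; [|exact b_summable].
  intros j. rewrite Rabs_mult, (Rabs_pos_eq (b j)) by apply b_range.
  pose proof (d_bound (b j * x)). pose proof (b_range j). nra.
Qed.

(** By the mean value theorem and the Lipschitz bound on [d], the [j]-th term has linearization
    error at most [(b j)^2 * (y - x)^2], hence at most [b j * (y - x)^2] because [b j <= 1]. Summing
    over [j] gives a quadratic error with constant [Series b]. *)
Lemma is_derive_dilation (x : R) :
  is_derive (fun y => Series (fun j => f (b j * y))) x
            (Series (fun j => b j * d (b j * x))).
Proof.
  apply is_derive_of_quadratic_error with (Series b). intros y.
  assert (Hbound : forall j,
    Rabs (f (b j * y) - f (b j * x) - (y - x) * (b j * d (b j * x)))
    <= (y - x) ^ 2 * b j).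
  { intros j.
    destruct (mvt_everywhere f d (b j * x) (b j * y) f_derive) as [u [Hu E]].
    rewrite E.
    replace (d u * (b j * y - b j * x) - (y - x) * (b j * d (b j * x)))
      with ((d u - d (b j * x)) * (b j * y - b j * x)) by ring.
    rewrite Rabs_mult.
    pose proof (d_lipschitz u (b j * x)) as Hl.
    pose proof (b_range j).
    set (w := Rabs (b j * y - b j * x)) in *.
    assert (Hw : w * w = b j * b j * (y - x) ^ 2).
    { unfold w. rewrite <- Rabs_mult, Rabs_pos_eq by apply Rle_0_sqr. ring. }
    pose proof (pow2_ge_0 (y - x)).
    assert (0 <= w) by apply Rabs_pos.
    apply Rle_trans with (w * w); [apply Rmult_le_compat_r; lra|].
    rewrite Hw, (Rmult_comm (_ ^ 2)).
    apply Rmult_le_compat_r; nra. }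
  assert (Hq : ex_series (fun j => (y - x) ^ 2 * b j))
    by apply (ex_series_scal_l ((y - x) ^ 2) b b_summable).
  rewrite (Rmult_comm (Series _) (y - x)), <- Series_scal_l.
  rewrite <- Series_minus by apply ex_series_dilation.
  rewrite <- Series_minus.
  - rewrite (Rmult_comm (Series b)), <- Series_scal_l.
    eapply Rle_trans; [apply Series_Rabs|].
    + apply ex_series_Rabs_le with (2 := Hq).
      intros j. rewrite Rabs_Rabsolu. apply Hbound.
    + apply Series_le; [|exact Hq]. intros j; split; [apply Rabs_pos | apply Hbound].
  - apply (ex_series_minus (fun j => f (b j * y)) (fun j => f (b j * x)));
      apply ex_series_dilation.
  - apply (ex_series_scal_l (y - x) (fun j => b j * d (b j * x))).
    apply ex_series_dilation_derive.
Qed.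

End DilationSeries.

(** * Bounds on the derivatives of [atan t] and [ln (1 + t²) / 2] *)

Lemma inv_1_sqr_bound (u : R) : Rabs (/ (1 + u²)) <= 1.
Proof.
  pose proof (Rle_0_sqr u). rewrite Rabs_inv, Rabs_pos_eq by lra.
  rewrite <- Rinv_1. apply Rinv_le_contravar; lra.
Qed.

Lemma Rabs_div_le (a c m : R) : 0 < c -> Rabs a <= m * c -> Rabs (a / c) <= m.
Proof.
  intros Hc H. unfold Rdiv. rewrite Rabs_mult, Rabs_inv, (Rabs_pos_eq c) by lra.
  apply Rmult_le_reg_r with c; [exact Hc|].
  rewrite Rmult_assoc, Rinv_l; lra.
Qed.

Lemma inv_1_sqr_lipschitz (u v : R) :
  Rabs (/ (1 + u²) - / (1 + v²)) <= Rabs (u - v).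
Proof.
  unfold Rsqr.
  replace (/ (1 + u * u) - / (1 + v * v))
    with ((u - v) * (- (u + v)) / ((1 + u * u) * (1 + v * v))) by (field; nra).
  apply Rabs_div_le; [apply Rmult_lt_0_compat; nra|].
  rewrite Rabs_mult. apply Rmult_le_compat_l; [apply Rabs_pos|].
  apply Rabs_le.
  assert (0 <= u * u * (v * v)) by (apply Rmult_le_pos; apply Rle_0_sqr).
  (* These squares give [Rabs u <= u² + 1/4], and likewise for [v], so [Rabs (u + v)] is at most
     [1 + u² + v²]. *)
  pose proof (pow2_ge_0 (u - / 2)). pose proof (pow2_ge_0 (u + / 2)).
  pose proof (pow2_ge_0 (v - / 2)). pose proof (pow2_ge_0 (v + / 2)).
  split; lra.
Qed.

Lemma half_ln_derive (u : R) :
  is_derive (fun t => ln (1 + t²) / 2) u (u / (1 + u²)).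
Proof.
  unfold Rsqr. auto_derive; [nra|]. field; nra.
Qed.

Lemma div_1_sqr_bound (u : R) : Rabs (u / (1 + u²)) <= 1.
Proof.
  unfold Rsqr. apply Rabs_div_le; [nra|]. apply Rabs_le. split; nra.
Qed.

Lemma div_1_sqr_lipschitz (u v : R) :
  Rabs (u / (1 + u²) - v / (1 + v²)) <= Rabs (u - v).
Proof.
  unfold Rsqr.
  replace (u / (1 + u * u) - v / (1 + v * v))
    with ((u - v) * (1 - u * v) / ((1 + u * u) * (1 + v * v))) by (field; nra).
  apply Rabs_div_le; [apply Rmult_lt_0_compat; nra|].
  rewrite Rabs_mult. apply Rmult_le_compat_l; [apply Rabs_pos|].
  apply Rabs_le.
  assert (0 <= u * u * (v * v)) by (apply Rmult_le_pos; apply Rle_0_sqr).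
  (* These squares bound [Rabs (u * v)] by [(u² + v²) / 2]. *)
  pose proof (pow2_ge_0 (u - v)). pose proof (pow2_ge_0 (u + v)).
  split; lra.
Qed.

Lemma exp_half_ln (u : R) : exp (ln (1 + u²) / 2) = sqrt (1 + u²).
Proof.
  pose proof (Rle_0_sqr u). symmetry. apply sqrt_lem_1; [lra | |].
  - apply Rlt_le, exp_pos.
  - rewrite <- exp_plus.
    replace (ln (1 + u²) / 2 + ln (1 + u²) / 2) with (ln (1 + u²)) by lra.
    apply exp_ln. lra.
Qed.

Lemma term_le_Series (u : nat -> R) (j : nat) :
  (forall i, 0 <= u i) -> ex_series u -> u j <= Series u.
Proof.
  intros Hu Hs.
  assert (Hincr : forall n, sum_n u n <= sum_n u (S n)).
  { intros n. rewrite sum_Sn. unfold plus; simpl. pose proof (Hu (S n)). lra. }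
  apply Rle_trans with (sum_n u j).
  - destruct j as [|j]; [rewrite sum_O; apply Rle_refl|].
    rewrite sum_Sn. unfold plus; simpl.
    assert (0 <= sum_n u j); [|lra].
    clear -Hu. induction j as [|j IH]; [rewrite sum_O; apply Hu|].
    rewrite sum_Sn. unfold plus; simpl. pose proof (Hu (S j)). lra.
  - exact (is_lim_seq_incr_compare _ _ (Series_correct _ Hs) Hincr j).
Qed.

(* [C_derive] is the derivative along the real direction, so complex
   differentiability of [F] is not an issue. *)
Lemma C_derive_real (F : C -> C) (g : R -> R) (x l : R) :
  (forall y, F (RtoC y) = RtoC (g y)) -> is_derive g x l ->
  C_derive F (RtoC x) = RtoC l.
Proof.
  intros HF Hg.
  assert (Hquot : forall y, y <> x ->
    ((F (y, 0) - F (RtoC x)) / ((y, 0) - RtoC x))%C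
    = RtoC ((g y - g x) / (y - x))).
  { intros y Hy. change (y, 0) with (RtoC y).
    rewrite !HF, <- !RtoC_minus, <- RtoC_div; [reflexivity | lra]. }
  assert (Hlim : is_lim (fun y => (g y - g x) / (y - x)) x l).
  { apply is_lim_spec. intros eps. apply is_derive_Reals in Hg.
    destruct (Hg eps (cond_pos eps)) as [delta Hdelta].
    exists delta. intros y Hy Hyx.
    specialize (Hdelta (y - x)). replace (x + (y - x)) with y in Hdelta
      by (simpl; lra).
    apply Hdelta; [lra | exact Hy]. }
  unfold C_derive, C_lim. change (fst (RtoC x)) with x.
  change (RtoC l) with (l, 0). f_equal.
  - rewrite (Lim_ext_loc (fun y => (g y - g x) / (y - x))).
    + rewrite (is_lim_unique _ _ _ Hlim). reflexivity.
    (* The radius 1 is arbitrary, as the two quotients agree at every [y <> x]. *)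
    + exists (mkposreal 1 Rlt_0_1). intros y _ Hy.
      symmetry. exact (f_equal fst (Hquot y Hy)).
  - rewrite (Lim_ext_loc (fun _ => 0)).
    + rewrite Lim_const. reflexivity.
    + exists (mkposreal 1 Rlt_0_1). intros y _ Hy.
      symmetry. exact (f_equal snd (Hquot y Hy)).
Qed.

(** * Phase and log-modulus of [E_q] on the imaginary axis *)

Section RealLine.

Variable q : R.
Hypothesis q_range : 0 < q < 1.

(** [scale], [phase] and [log_modulus] are the b, T and L of the overview; [phase'] is the termwise
    derivative of [phase]. *)
Definition scale (j : nat) : R := (1 - q) * q ^ j.

Definition phase (x : R) : R := Series (fun j => atan (scale j * x)).

Definition log_modulus (x : R) : R :=
  Series (fun j => ln (1 + (scale j * x)²) / 2).

Definition phase' (x : R) : R :=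
  Series (fun j => scale j * / (1 + (scale j * x)²)).

Lemma scale_pos (j : nat) : 0 < scale j.
Proof. apply Rmult_lt_0_compat; [lra | apply pow_lt; lra]. Qed.

Lemma scale_range (j : nat) : 0 <= scale j <= 1.
Proof.
  split; [apply Rlt_le, scale_pos|]. unfold scale.
  assert (0 < q ^ j) by (apply pow_lt; lra).
  assert (q ^ j <= 1 ^ j) by (apply pow_incr; lra).
  rewrite pow1 in *. nra.
Qed.

Lemma scale_summable : ex_series scale.
Proof.
  apply (ex_series_scal_l (1 - q) (fun j => q ^ j)), ex_series_geom.
  rewrite Rabs_pos_eq; lra.
Qed.

Lemma ex_series_phase (x : R) : ex_series (fun j => atan (scale j * x)).
Proof.
  exact (ex_series_dilation atan _ scale is_derive_atan inv_1_sqr_bound atan_0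
           scale_range scale_summable x).
Qed.

Lemma is_derive_phase (x : R) : is_derive phase x (phase' x).
Proof.
  exact (is_derive_dilation atan _ scale is_derive_atan inv_1_sqr_bound
           inv_1_sqr_lipschitz atan_0 scale_range scale_summable x).
Qed.

Lemma ex_series_phase' (x : R) :
  ex_series (fun j => scale j * / (1 + (scale j * x)²)).
Proof.
  exact (ex_series_dilation_derive (fun u => / (1 + u²)) scale inv_1_sqr_bound
           scale_range scale_summable x).
Qed.

Lemma half_ln_0 : ln (1 + 0²) / 2 = 0.
Proof. rewrite Rsqr_0, Rplus_0_r, ln_1. lra. Qed.

Lemma ex_series_log_modulus (x : R) :
  ex_series (fun j => ln (1 + (scale j * x)²) / 2).
Proof.
  exact (ex_series_dilation (fun t => ln (1 + t²) / 2) _ scale half_ln_derive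
           div_1_sqr_bound half_ln_0 scale_range scale_summable x).
Qed.

(** The value of this derivative is left open: at a zero, the product rule multiplies it by a
    vanishing factor. *)
Lemma ex_derive_log_modulus (x : R) : ex_derive log_modulus x.
Proof.
  eexists.
  exact (is_derive_dilation (fun t => ln (1 + t²) / 2) _ scale half_ln_derive
           div_1_sqr_bound div_1_sqr_lipschitz half_ln_0 scale_range
           scale_summable x).
Qed.

Lemma phase_opp (x : R) : phase (- x) = - phase x.
Proof.
  unfold phase. rewrite <- Series_opp. apply Series_ext. intros j.
  rewrite <- atan_opp. f_equal. ring.
Qed.

Lemma log_modulus_opp (x : R) : log_modulus (- x) = log_modulus x.
Proof.
  unfold log_modulus. apply Series_ext. intros j.
  rewrite Ropp_mult_distr_r_reverse, <- Rsqr_neg. reflexivity.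
Qed.

(** Since [scale (S j) * (x / q) = scale j * x], dilating by [1 / q] shifts the series by one index
    and contributes just one new term. *)
Lemma phase_dilate (x : R) :
  phase (x / q) = atan (scale 0 * (x / q)) + phase x.
Proof.
  unfold phase. rewrite Series_incr_1 by apply ex_series_phase. f_equal.
  apply Series_ext. intros j. f_equal. unfold scale. simpl. field. lra.
Qed.

(** * Lower bound on [x * phase' x] and separation of zeros *)

Lemma phase'_term_le (x : R) (j : nat) :
  scale j * / (1 + (scale j * x)²) <= phase' x.
Proof.
  apply (term_le_Series (fun j => scale j * / (1 + (scale j * x)²)));
    [|apply ex_series_phase'].
  intros i. pose proof (Rle_0_sqr (scale i * x)).
  apply Rmult_le_pos; [apply scale_range | apply Rlt_le, Rinv_0_lt_compat; lra].
Qed.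

Lemma phase'_pos (x : R) : 0 < phase' x.
Proof.
  apply Rlt_le_trans with (2 := phase'_term_le x 0).
  pose proof (Rle_0_sqr (scale 0 * x)).
  apply Rmult_lt_0_compat; [apply scale_pos | apply Rinv_0_lt_compat; lra].
Qed.

Lemma phase_increasing (x y : R) : x < y -> phase x < phase y.
Proof.
  intros Hxy. destruct (mvt_everywhere phase phase' x y is_derive_phase) as [u [_ E]].
  pose proof (phase'_pos u). nra.
Qed.

(* Some [scale j * x] lies in [(q, 1]], or else [scale 0 * x <= 1]. *)
Lemma exists_scale_range (x : R) :
  0 < x -> exists j, Rmin q (scale 0 * x) <= scale j * x <= 1.
Proof.
  intros Hx.
  destruct (pow_lt_1_zero q) with (y := / (scale 0 * x)) as [N HN].
  - rewrite Rabs_pos_eq; lra.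
  - apply Rinv_0_lt_compat, Rmult_lt_0_compat; [apply scale_pos | exact Hx].
  - assert (HN1 : scale N * x <= 1).
    { specialize (HN N (le_n N)).
      assert (0 < q ^ N) by (apply pow_lt; lra).
      assert (H0 : 0 < scale 0 * x)
        by (apply Rmult_lt_0_compat; [apply scale_pos | exact Hx]).
      rewrite Rabs_pos_eq in HN by lra.
      apply Rmult_lt_compat_l with (r := scale 0 * x) in HN; [|exact H0].
      rewrite Rinv_r in HN by lra.
      unfold scale in *. simpl in HN. lra. }
    (* Descend from [N] to the first index where [scale j * x <= 1]. If it is not 0, the preceding
       value exceeds 1, so this one, [q] times it, exceeds [q]. *)
    clear HN. induction N as [|N IH].
    + exists 0%nat. split; [apply Rmin_r | exact HN1].
    + destruct (Rle_dec (scale N * x) 1) as [Hle|Hgt]; [exact (IH Hle)|].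
      exists (S N). split; [|exact HN1].
      apply Rle_trans with q; [apply Rmin_l|].
      replace (scale (S N) * x) with (q * (scale N * x))
        by (unfold scale; simpl; ring).
      nra.
Qed.

(** A single term suffices: with [t = scale j * x] between [m] and 1, its contribution
    [t / (1 + t²)] is at least [t / 2], hence at least [m / 2]. *)
Lemma phase'_lower_bound (x : R) :
  0 < x -> Rmin q (scale 0 * x) / 2 <= x * phase' x.
Proof.
  intros Hx. destruct (exists_scale_range x Hx) as [j Hj].
  set (m := Rmin q (scale 0 * x)) in *.
  apply Rle_trans with (x * (scale j * / (1 + (scale j * x)²))).
  2: apply Rmult_le_compat_l; [lra | apply phase'_term_le].
  assert (Ht : 0 < scale j * x)
    by (apply Rmult_lt_0_compat; [apply scale_pos | exact Hx]).
  replace (x * (scale j * / (1 + (scale j * x)²)))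
    with (scale j * x * / (1 + (scale j * x)²)) by ring.
  set (t := scale j * x) in *. unfold Rsqr.
  assert (/ 2 <= / (1 + t * t)) by (apply Rinv_le_contravar; nra).
  nra.
Qed.

(** If [y <= x / q], the phase grows from [x] to [y] by a positive amount below [PI / 2], where the
    sine is positive. The hypothesis on [sin] serves zeros of sine and of cosine alike, since in
    both cases the phases differ by a multiple of [PI]. *)
Lemma zeros_separated (x y : R) :
  0 < x < y -> sin (phase y - phase x) = 0 -> x / q < y.
Proof.
  intros Hxy Hsin. apply Rnot_le_lt. intros Hle.
  pose proof (phase_increasing x y (proj2 Hxy)) as Hlt.
  assert (phase y <= phase (x / q)).
  { destruct Hle as [Hle|Hle]; [apply Rlt_le, phase_increasing, Hle|].
    rewrite Hle. apply Rle_refl. }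
  rewrite phase_dilate in *.
  pose proof (atan_bound (scale 0 * (x / q))). pose proof PI_RGT_0.
  assert (0 < sin (phase y - phase x)) by (apply sin_gt_0; lra).
  lra.
Qed.

(** * Polar form of [E_q], and [Sin_q] and [Cos_q] on the real line *)

Lemma qpoch_polar (x : R) (n : nat) :
  qpoch (- (1 - RtoC q) * (Ci * RtoC x))%C q (S n) =
  (exp (sum_n (fun j => ln (1 + (scale j * x)²) / 2) n)
     * cos (sum_n (fun j => atan (scale j * x)) n),
   exp (sum_n (fun j => ln (1 + (scale j * x)²) / 2) n)
     * sin (sum_n (fun j => atan (scale j * x)) n)).
Proof.
  (* With [t = scale n * x], each factor is [1 + i t], of modulus [sqrt (1 + t²)] and argument
     [atan t]. The [S n] factors match [sum_n], which includes the index [n]. *)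
  assert (Hfactor : forall n,
    (1 - - (1 - RtoC q) * (Ci * RtoC x) * RtoC (q ^ n))%C =
    (exp (ln (1 + (scale n * x)²) / 2) * cos (atan (scale n * x)),
     exp (ln (1 + (scale n * x)²) / 2) * sin (atan (scale n * x)))).
  { intros k. rewrite exp_half_ln, cos_atan, sin_atan.
    assert (0 < sqrt (1 + (scale k * x)²)).
    { apply sqrt_lt_R0. pose proof (Rle_0_sqr (scale k * x)). lra. }
    unfold Cminus, Cmult, Cplus, Copp, Ci, RtoC; simpl.
    f_equal; [field; lra|]. unfold scale. field.
    unfold scale in *. lra. }
  induction n as [|n IH].
  - rewrite !sum_O, <- Hfactor. simpl. ring.
  - change (qpoch ?z q (S (S n))) with
      (qpoch z q (S n) * (1 - z * RtoC (q ^ S n)))%C.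
    rewrite IH, Hfactor, !sum_Sn.
    unfold plus; simpl. rewrite exp_plus, cos_plus, sin_plus.
    unfold Cmult; simpl. f_equal; ring.
Qed.

Lemma E_q_imaginary (x : R) :
  E_q q (Ci * RtoC x) =
  (exp (log_modulus x) * cos (phase x), exp (log_modulus x) * sin (phase x)).
Proof.
  assert (Hl : is_lim_seq (sum_n (fun j => ln (1 + (scale j * x)²) / 2))
                          (log_modulus x))
    by exact (Series_correct _ (ex_series_log_modulus x)).
  assert (Ht : is_lim_seq (sum_n (fun j => atan (scale j * x))) (phase x))
    by exact (Series_correct _ (ex_series_phase x)).
  assert (Hlim : forall g : R -> R, continuity g ->
    is_lim_seq (fun n =>
      exp (sum_n (fun j => ln (1 + (scale j * x)²) / 2) n)
      * g (sum_n (fun j => atan (scale j * x)) n))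
      (exp (log_modulus x) * g (phase x))).
  { intros g Hg. apply is_lim_seq_mult'.
    - apply is_lim_seq_continuous with (2 := Hl).
      apply derivable_continuous, derivable_exp.
    - apply is_lim_seq_continuous with (2 := Ht). apply Hg. }
  unfold E_q, qpoch_inf, C_lim_seq. f_equal.
  (* Dropping the empty product leaves the limit unchanged and makes [qpoch_polar] applicable. *)
  - rewrite <- Lim_seq_incr_1.
    rewrite (is_lim_seq_unique _ (exp (log_modulus x) * cos (phase x)));
      [reflexivity|].
    eapply is_lim_seq_ext; [|exact (Hlim cos continuity_cos)].
    intros n. rewrite qpoch_polar. reflexivity.
  - rewrite <- Lim_seq_incr_1.
    rewrite (is_lim_seq_unique _ (exp (log_modulus x) * sin (phase x)));
      [reflexivity|].
    eapply is_lim_seq_ext; [|exact (Hlim sin continuity_sin)].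
    intros n. rewrite qpoch_polar. reflexivity.
Qed.

(** Moving the sign into [x] yields the complex conjugate, because [log_modulus] is even and [phase]
    is odd. *)
Lemma E_q_imaginary_opp (x : R) :
  E_q q (- (Ci * RtoC x)) =
  (exp (log_modulus x) * cos (phase x), - (exp (log_modulus x) * sin (phase x))).
Proof.
  replace (- (Ci * RtoC x))%C with (Ci * RtoC (- x))%C
    by (rewrite RtoC_opp; ring).
  rewrite E_q_imaginary, log_modulus_opp, phase_opp, cos_neg, sin_neg.
  f_equal. ring.
Qed.

Lemma Sin_q_real (x : R) :
  Sin_q q (RtoC x) = RtoC (exp (log_modulus x) * sin (phase x)).
Proof.
  unfold Sin_q. rewrite E_q_imaginary, E_q_imaginary_opp.
  unfold Cdiv, Cinv, Cminus, Cmult, Cplus, Copp, Ci, RtoC; simpl.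
  f_equal; field.
Qed.

Lemma Cos_q_real (x : R) :
  Cos_q q (RtoC x) = RtoC (exp (log_modulus x) * cos (phase x)).
Proof.
  unfold Cos_q. rewrite E_q_imaginary, E_q_imaginary_opp.
  unfold Cdiv, Cinv, Cminus, Cmult, Cplus, Copp, Ci, RtoC; simpl.
  f_equal; field.
Qed.

(** * Size of the quotient at a zero *)

Lemma is_derive_polar (g g' : R -> R) (x : R) :
  (forall t, is_derive g t (g' t)) -> g (phase x) = 0 ->
  is_derive (fun y => exp (log_modulus y) * g (phase y)) x
            (exp (log_modulus x) * g' (phase x) * phase' x).
Proof.
  intros Hg H0.
  destruct (ex_derive_log_modulus x) as [l Hl].
  assert (He : is_derive (fun y => exp (log_modulus y)) x (l * exp (log_modulus x)))
    by exact (is_derive_comp exp log_modulus x _ _ (is_derive_exp _) Hl).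
  assert (Hp : is_derive (fun y => g (phase y)) x (phase' x * g' (phase x)))
    by exact (is_derive_comp g phase x _ _ (Hg _) (is_derive_phase x)).
  pose proof (is_derive_mult _ _ x _ _ He Hp Rmult_comm) as H.
  replace (exp (log_modulus x) * g' (phase x) * phase' x)
    with (plus (mult (l * exp (log_modulus x)) (g (phase x)))
               (mult (exp (log_modulus x)) (phase' x * g' (phase x)))); [exact H|].
  unfold plus, mult; simpl. rewrite H0. ring.
Qed.

(** The exponentials cancel and [h], [g'] have equal absolute value at the zero, so the quotient has
    modulus [/ phase' x], controlled by [phase'_lower_bound]. Evaluating the minimum at [x1] makes
    the constant uniform over all zeros beyond [x1]. *)
Lemma zero_quotient_le (F G : C -> C) (g g' h : R -> R) (x x1 : R) :
  (forall y, F (RtoC y) = RtoC (exp (log_modulus y) * g (phase y))) ->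
  (forall y, G (RtoC y) = RtoC (exp (log_modulus y) * h (phase y))) ->
  (forall t, is_derive g t (g' t)) ->
  Rabs (h (phase x)) = Rabs (g' (phase x)) ->
  g (phase x) = 0 -> g' (phase x) <> 0 -> 0 < x1 <= x ->
  Cmod (G (RtoC x) / C_derive F (RtoC x))
  <= 2 / Rmin q (scale 0 * x1) * x.
Proof.
  intros HF HG Hg Hh H0 Hg' Hx.
  rewrite (C_derive_real F _ x _ HF (is_derive_polar g g' x Hg H0)), HG.
  pose proof (phase'_pos x) as Hp.
  pose proof (exp_pos (log_modulus x)) as He.
  rewrite Cmod_div.
  2: { intros E. apply RtoC_inj in E.
       repeat (apply Rmult_integral in E; destruct E as [E|E]; try lra). }
  rewrite !Cmod_R, !Rabs_mult, Hh, (Rabs_pos_eq (phase' x)) by lra.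
  rewrite (Rabs_pos_eq (exp _)) by lra.
  assert (0 < Rabs (g' (phase x))) by (apply Rabs_pos_lt; exact Hg').
  replace (_ / _) with (/ phase' x) by (field; lra).
  pose proof (phase'_lower_bound x ltac:(lra)) as Hlow.
  assert (Hm : Rmin q (scale 0 * x1) <= Rmin q (scale 0 * x)).
  { apply Rle_min_compat_l, Rmult_le_compat_l; [apply scale_range | lra]. }
  assert (Hm0 : 0 < Rmin q (scale 0 * x1)).
  { apply Rmin_glb_lt; [lra|]. apply Rmult_lt_0_compat; [apply scale_pos | lra]. }
  set (m := Rmin q (scale 0 * x1)) in *.
  apply Rmult_le_reg_r with (phase' x); [exact Hp|].
  rewrite Rinv_l by lra.
  apply Rmult_le_reg_l with (m / 2); [lra|].
  replace (m / 2 * (2 / m * x * phase' x)) with (x * phase' x) by (field; lra).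
  lra.
Qed.

Lemma polar_zero (F : C -> C) (g : R -> R) (x : R) :
  (forall y, F (RtoC y) = RtoC (exp (log_modulus y) * g (phase y))) ->
  F (RtoC x) = RtoC 0 -> g (phase x) = 0.
Proof.
  intros HF H. rewrite HF in H. apply RtoC_inj, Rmult_integral in H.
  pose proof (exp_pos (log_modulus x)). destruct H; [lra | assumption].
Qed.

(** * Geometric decay and absolute convergence *)

Lemma Cmod_RCpower (x : R) (s : C) : Cmod (RCpower x s) = Rpower x (Re s).
Proof.
  unfold Cmod, RCpower; simpl. set (t := (Im s * ln x)%R).
  assert (0 < Rpower x (Re s)) by apply exp_pos.
  pose proof (sin2_cos2 t) as H2. unfold Rsqr in H2.
  replace (_ + _) with (Rpower x (Re s) * Rpower x (Re s)
    * (sin t * sin t + cos t * cos t)) by ring.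
  rewrite H2, Rmult_1_r. apply sqrt_square. lra.
Qed.

(** Each term is at most [K] times the power [1 - Re s] of [x n]. This exponent is negative and [x]
    grows at least by the factor [1 / q], so a geometric series of ratio [Rpower q (Re s - 1)]
    dominates. *)
Lemma abs_convergent_geometric (x : nat -> R) (r : nat -> C) (s : C) (K : R) :
  (forall k, (1 <= k)%nat -> 0 < x k) ->
  (forall k, (1 <= k)%nat -> x k / q <= x (S k)) ->
  1 < Re s ->
  (forall k, (1 <= k)%nat -> Cmod (r k) <= K * x k) ->
  abs_convergent_from1 (fun n => (1 / RCpower (x n) s * r n)%C).
Proof.
  intros Hx Hgrow Hs Hr. set (sigma := Re s) in *.
  assert (Hpow : forall n,
    Rpower (x (S n)) (1 - sigma) <= Rpower (x 1%nat) (1 - sigma)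
                                    * Rpower q (sigma - 1) ^ n).
  { induction n as [|n IH]; [rewrite pow_O, Rmult_1_r; apply Rle_refl|].
    assert (Hn : 0 < x (S n)) by (apply Hx; lia).
    assert (Hnq : 0 < x (S n) / q) by (apply Rdiv_lt_0_compat; lra).
    apply Rle_trans with (Rpower (x (S n) / q) (1 - sigma)).
    (* The negative exponent reverses monotonicity, so the comparison passes through inverses of
       powers with exponent [sigma - 1]. *)
    - replace (1 - sigma) with (- (sigma - 1)) by ring. rewrite !Rpower_Ropp.
      apply Rinv_le_contravar; [apply exp_pos|].
      apply Rle_Rpower_l; [lra|]. split; [exact Hnq | apply Hgrow; lia].
    - unfold Rdiv. rewrite <- Rpower_mult_distr
        by (try apply Rinv_0_lt_compat; lra).
      replace (Rpower (/ q) (1 - sigma)) with (Rpower q (sigma - 1)).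
      2: { unfold Rpower. rewrite ln_Rinv by lra. f_equal. ring. }
      simpl. assert (0 < Rpower q (sigma - 1)) by apply exp_pos. nra. }
  assert (Hratio : 0 < Rpower q (sigma - 1) < 1).
  { split; [apply exp_pos|]. pose proof (ln_increasing q 1) as Hln.
    rewrite ln_1 in Hln.
    apply Rlt_le_trans with (exp 0); [apply exp_increasing; nra|].
    rewrite exp_0. apply Rle_refl. }
  assert (HK : 0 <= K).
  { pose proof (Hx 1%nat (le_n 1)). pose proof (Hr 1%nat (le_n 1)).
    pose proof (Cmod_ge_0 (r 1%nat)). nra. }
  unfold abs_convergent_from1.
  apply ex_series_Rabs_le with
    (fun n => K * Rpower (x 1%nat) (1 - sigma) * Rpower q (sigma - 1) ^ n).
  - intros n. rewrite Rabs_pos_eq by apply Cmod_ge_0.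
    assert (Hn : 0 < x (S n)) by (apply Hx; lia).
    assert (Hp : 0 < Rpower (x (S n)) sigma) by apply exp_pos.
    rewrite Cmod_mult, Cmod_div, Cmod_1, Cmod_RCpower.
    2: { apply Cmod_gt_0. rewrite Cmod_RCpower. exact Hp. }
    fold sigma. rewrite Rmult_assoc.
    apply Rle_trans with (K * Rpower (x (S n)) (1 - sigma)).
    + unfold Rminus. rewrite Rpower_plus, Rpower_1, Rpower_Ropp by exact Hn.
      replace (K * (x (S n) * / Rpower (x (S n)) sigma))
        with (1 / Rpower (x (S n)) sigma * (K * x (S n))) by (field; lra).
      apply Rmult_le_compat_l; [|apply Hr; lia].
      apply Rlt_le, Rdiv_lt_0_compat; lra.
    + apply Rmult_le_compat_l; [exact HK | apply Hpow].
  - apply (ex_series_scal_l (K * Rpower (x 1%nat) (1 - sigma))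
             (fun n => Rpower q (sigma - 1) ^ n)).
    apply ex_series_geom. rewrite Rabs_pos_eq; lra.
Qed.

(** One statement for both series: [g] is the trigonometric factor of [F], and [h] that of [G]. The
    smallest zero [x 1] supplies the [x1] of [zero_quotient_le]. *)
Lemma abs_convergent_at_zeros (F G : C -> C) (g g' h : R -> R)
    (x : nat -> R) (s : C) :
  (forall y, F (RtoC y) = RtoC (exp (log_modulus y) * g (phase y))) ->
  (forall y, G (RtoC y) = RtoC (exp (log_modulus y) * h (phase y))) ->
  (forall t, is_derive g t (g' t)) ->
  (forall t, Rabs (h t) = Rabs (g' t)) ->
  (forall t, g t = 0 -> g' t <> 0) ->
  (forall t u, g t = 0 -> g u = 0 -> sin (u - t) = 0) ->
  positive_zeros F x -> 1 < Re s ->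
  abs_convergent_from1 (fun n =>
    (1 / RCpower (x n) s * (G (RtoC (x n)) / C_derive F (RtoC (x n))))%C).
Proof.
  intros HF HG Hg Hh Hg' Hsin [Hzero [Hincr _]] Hs.
  assert (H0 : forall k, (1 <= k)%nat -> g (phase (x k)) = 0).
  { intros k Hk. apply (polar_zero F g (x k) HF), Hzero, Hk. }
  assert (Hfirst : forall k, (1 <= k)%nat -> x 1%nat <= x k).
  { intros k Hk. induction Hk as [|k Hk IH]; [apply Rle_refl|].
    pose proof (Hincr k Hk). lra. }
  apply abs_convergent_geometric with (2 / Rmin q (scale 0 * x 1%nat)).
  - intros k Hk. apply Hzero, Hk.
  - intros k Hk. apply Rlt_le, zeros_separated.
    + split; [apply Hzero, Hk | apply Hincr, Hk].
    + apply Hsin; apply H0; lia.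
  - exact Hs.
  - intros k Hk. apply (zero_quotient_le F G g g' h); auto.
    split; [apply Hzero; lia | apply Hfirst, Hk].
Qed.

End RealLine.

Lemma sin_cos_not_both_0 (t : R) : sin t = 0 -> cos t <> 0.
Proof.
  intros H1 H2. pose proof (sin2_cos2 t) as H. rewrite H1, H2 in H.
  unfold Rsqr in H. lra.
Qed.

Open Scope C_scope.

Theorem corollary3p13 :
  forall (q : R) (xi eta : nat -> R) (s : C),
    (0 < q < 1)%R ->
    positive_zeros (Sin_q q) xi ->
    positive_zeros (Cos_q q) eta ->
    (1 < Re s)%R ->
    abs_convergent_from1 (fun n =>
      1 / RCpower (xi n) s *
      (Cos_q q (RtoC (xi n)) / C_derive (Sin_q q) (RtoC (xi n)))) /\
    abs_convergent_from1 (fun n =>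
      1 / RCpower (eta n) s *
      (Sin_q q (RtoC (eta n)) / C_derive (Cos_q q) (RtoC (eta n)))).
Proof.
  intros q xi eta s Hq Hxi Heta Hs. split.
  - apply (abs_convergent_at_zeros q Hq (Sin_q q) (Cos_q q) sin cos cos); auto.
    + apply Sin_q_real, Hq.
    + apply Cos_q_real, Hq.
    + apply is_derive_sin.
    + apply sin_cos_not_both_0.
    + intros t u Ht Hu. rewrite sin_minus, Ht, Hu. ring.
  (* Here [h = sin] and [g' = - sin] agree only up to sign, hence the absolute values in the common
     lemma. *)
  - apply (abs_convergent_at_zeros q Hq (Cos_q q) (Sin_q q)
             cos (fun t => (- sin t)%R) sin); auto.
    + apply Cos_q_real, Hq.
    + apply Sin_q_real, Hq.
    + apply is_derive_cos.
    + intros t. symmetry. apply Rabs_Ropp.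
    + intros t Ht E. apply (sin_cos_not_both_0 t); [lra | exact Ht].
    + intros t u Ht Hu. rewrite sin_minus, Ht, Hu. ring.
Qed.
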